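(* Let $T>0$, let $W=\{W_t,\ t\in[0,T]\}$ be a (standard, real) Brownian motion on a probability space $(\Omega,\mathcal F,P)$, and consider the stochastic differential equation $$X_t=\int_0^t b(X_s)\,ds+|W_t|,\qquad t\in[0,T],$$ where $b\colon\mathbb R\to\mathbb R$ is a measurable function satisfying: (H1) $b(0)=0$; (H2) $b$ is non-decreasing on $(0,\infty)$; (H3) $b$ is continuous on $[0,\infty)$, and of class $C^1$ with $b'$ non-increasing on $(0,\infty)$; (H7) $\displaystyle \operatorname{E}_P\Big[\int_0^T b'(|W_s|+)\,ds\Big]<\infty$. Then, for almost all sample paths of $W$, the equation has at most one non-negative path-by-path solution. If, moreover, $b\ge 0$ on an interval $(-\varepsilon,0)$ for some $\varepsilon>0$, then this non-negative solution is the unique path-by-path solution (i.e. for almost all sample paths of $W$ the equation has exactly one path-by-path solution, and it is non-negative).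
   Context: For $z\ge 0$, $b'(z+):=\lim_{x\downarrow z}b'(x)$; $b'(0+)$ may be $+\infty$. Path-by-path solution: the equation is solved $\omega$-by-$\omega$, i.e. for each fixed continuous sample path $\omega_\cdot$ of $W$ one considers the deterministic equation $x_t=\int_0^t b(x_s)\,ds+|\omega_t|$, $t\in[0,T]$, for a continuous unknown $x\colon[0,T]\to\mathbb R$ (no adaptedness to the filtration of the noise is required). A solution is non-negative if $x_t\ge0$ for all $t\in[0,T]$. *)

(* Defs.v *)
From HB Require Import structures.
From mathcomp Require Import all_boot all_order all_algebra.
From mathcomp Require Import all_classical all_reals all_analysis.
Set Implicit Arguments.
Unset Strict Implicit.
Unset Printing Implicit Defensive.
Import Order.TTheory GRing.Theory Num.Theory.
Import numFieldNormedType.Exports.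
Local Open Scope classical_set_scope.
Local Open Scope ring_scope.

(* The full product rule implies it for every subfamily: take A i = setT for
   the indices left out. *)
Definition mutually_independent (R : realType) (d : measure_display)
    (Omega : measurableType d) (P : probability Omega R) (n : nat)
    (X : 'I_n -> Omega -> R) : Prop :=
  forall A : 'I_n -> set R, (forall i, measurable (A i)) ->
    P (\bigcap_(i in [set: 'I_n]) (X i @^-1` A i)) =
    (\prod_(i < n) P (X i @^-1` A i))%E.

(* The process is indexed by all of R; only its restriction to [0, T] is
   constrained. normal_prob takes the standard deviation, not the variance, and
   is not a Dirac mass at standard deviation 0, whence s < t below. *)
Record brownian_motion (R : realType) (d : measure_display)
    (Omega : measurableType d) (P : probability Omega R) (T : R)
    (W : R -> Omega -> R) : Prop := BrownianMotion {
  bm_measurable : forall t, 0 <= t <= T -> measurable_fun [set: Omega] (W t) ;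
  bm_start : {ae P, forall w, W 0 w = 0} ;
  bm_indep : forall (n : nat) (t : nat -> R),
    (forall i, (i <= n)%N -> 0 <= t i <= T) ->
    (forall i, (i < n)%N -> t i <= t i.+1) ->
    mutually_independent P (fun (i : 'I_n) w => W (t i.+1) w - W (t i) w) ;
  bm_normal : forall s t, 0 <= s -> s < t -> t <= T ->
    forall A : set R, measurable A ->
      P ((fun w => W t w - W s w) @^-1` A) =
      normal_prob 0 (Num.sqrt (t - s)) A ;
  bm_continuous :
    {ae P, forall w, {within `[0, T], continuous (fun t => W t w)}} }.

(* Taken in \bar R, so that b'(0+) may be +oo. *)
Definition right_limit_derivative (R : realType) (b : R -> R) (z : R) : \bar R :=
  lim ((derive1 b x)%:E @[x --> z^'+]).

(* om is one fixed sample path. Integrability is required because b need not be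
   bounded on bounded sets of negative numbers, and because the library's
   integral is total. *)
Definition path_solution (R : realType) (T : R) (b om x : R -> R) : Prop :=
  [/\ {within `[0, T], continuous x},
      (@lebesgue_measure R).-integrable `[0, T] (fun s => (b (x s))%:E) &
      forall t, 0 <= t <= T ->
        x t = \int[@lebesgue_measure R]_(s in `[0, t]) b (x s) + `|om t| ].

Definition nonneg_path (R : realType) (T : R) (x : R -> R) : Prop :=
  forall t, 0 <= t <= T -> 0 <= x t.

Definition agree_on_horizon (R : realType) (T : R) (x y : R -> R) : Prop :=
  forall t, 0 <= t <= T -> x t = y t.

(* Main.v *)
Require Import Defs.
From HB Require Import structures.
From mathcomp Require Import all_boot all_order all_algebra.
From mathcomp Require Import all_classical all_reals all_analysis.
From mathcomp Require Import measurable_realfun ring lra.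
Set Implicit Arguments.
Unset Strict Implicit.
Unset Printing Implicit Defensive.
Import Order.TTheory GRing.Theory Num.Theory.
Import numFieldNormedType.Exports.
Local Open Scope classical_set_scope.
Local Open Scope ring_scope.

(** The drift b is concave on the half-line of non-negative numbers, vanishes at 0
    and is non-decreasing there, hence non-negative. So every non-negative
    solution x satisfies x_t >= |om_t|, since the integral term can only push it
    up. For two non-negative solutions x and y, the mean value theorem and the
    monotonicity of b' give
      |b (x_s) - b (y_s)| <= b'(|om_s|+) |x_s - y_s|
    (drift_lipschitz): the noise itself keeps both solutions in the region where
    b is Lipschitz, with a constant that depends on s but is integrable over
    [0, T] for almost every path by the moment hypothesis. Gronwall's lemma with
    an integrable kernel (gronwall_zero) then forces x = y.

    The moment hypothesis bounds the expectation of a time integral. That it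
    makes the time integral almost surely finite needs the measurability of that
    integral in the sample point. The paths being only almost surely continuous,
    this is obtained for a version of W whose paths are all continuous
    (measurable_caratheodory), and transferred back through the definition of
    the integral of a possibly non-measurable function
    (ae_fin_num_lower_integral).

    If b is also non-negative just below 0, a solution cannot reach a level
    -eps: up to the first time it did so, its drift would have been non-negative,
    so it would still be above |om| (solution_nonneg). Every solution is therefore
    non-negative. A solution exists for every continuous path, as the limit of
    the Picard iterates started at |om|: they increase because b does, and stay
    below an exponential because a concave function grows at most linearly
    (picard_existence). *)

(** * Concave drifts *)

Record concave_drift (R : realType) (b : R -> R) : Prop := ConcaveDrift {
  drift0 : b 0 = 0 ;
  drift_le : forall x y : R, 0 < x -> x <= y -> b x <= b y ;
  drift_cont : {within `[0, +oo[, continuous b} ;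
  drift_derivable : forall x : R, 0 < x -> derivable b x 1 ;
  drift_deriv_cont : forall x : R, 0 < x -> {for x, continuous (derive1 b)} ;
  drift_deriv_noninc : forall x y : R,
    0 < x -> x <= y -> derive1 b y <= derive1 b x }.

Lemma drift_MVT (R : realType) (b : R -> R) (bH : concave_drift b) (x y : R) :
  0 <= x -> x < y -> exists2 c, x < c < y & b y - b x = derive1 b c * (y - x).
Proof.
move=> x0 xy; have [||c] := @MVT R b (derive1 b) x y xy.
- move=> z; rewrite in_itv/= => /andP[xz _].
  have z0 : 0 < z by exact: le_lt_trans xz.
  rewrite derive1E; apply: derivableP; exact: drift_derivable bH _ z0.
- apply: continuous_subspaceW (drift_cont bH) => z /=.
  by rewrite !in_itv/= => /andP[xz _]; rewrite andbT (le_trans x0).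
- by rewrite in_itv/= => cxy ->; exists c.
Qed.

(** By concavity a negative slope would persist to the right of x, and b would
    decrease there. *)
Lemma drift_deriv_ge0 (R : realType) (b : R -> R) (bH : concave_drift b) (x : R) :
  0 < x -> 0 <= derive1 b x.
Proof.
move=> x0; rewrite leNgt; apply/negP => bx0.
have [||c /andP[xc _] bE] := drift_MVT bH (x := x) (y := x + 1).
- exact: ltW.
- by rewrite ltrDl.
have := drift_le bH x0 (y := x + 1); rewrite lerDl ler01 => /(_ isT).
rewrite -subr_ge0 bE addrAC subrr add0r mulr1 leNgt => /negP; apply.
by apply: le_lt_trans bx0; apply: drift_deriv_noninc => //; exact: ltW.
Qed.

Lemma drift_mono (R : realType) (b : R -> R) (bH : concave_drift b) (x y : R) :
  0 <= x -> x <= y -> b x <= b y.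
Proof.
move=> x0; rewrite le_eqVlt => /predU1P[->//|xy].
rewrite -subr_ge0; have [c /andP[xc _] ->] := drift_MVT bH x0 xy.
by rewrite mulr_ge0// ?subr_ge0 ?(ltW xy)// drift_deriv_ge0// (le_lt_trans x0).
Qed.

Lemma drift_ge0 (R : realType) (b : R -> R) (bH : concave_drift b) (x : R) :
  0 <= x -> 0 <= b x.
Proof. by move=> x0; rewrite -{1}(drift0 bH); exact: drift_mono. Qed.

(** Beyond 1 a concave function stays below its tangent at 1; on [0, 1] it is at
    most b 1. *)
Lemma drift_affine_bound (R : realType) (b : R -> R) (bH : concave_drift b)
    (x : R) : 0 <= x -> b x <= b 1 + derive1 b 1 * x.
Proof.
move=> x0; have b'1 : 0 <= derive1 b 1 by exact: drift_deriv_ge0.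
have [x1|x1] := leP x 1.
  by rewrite (le_trans (drift_mono bH x0 x1))// lerDl mulr_ge0.
have [c /andP[c1 _] /(canRL (subrK _)) ->] := drift_MVT bH ler01 x1.
rewrite addrC lerD2l (@le_trans _ _ (derive1 b 1 * (x - 1)))//.
  rewrite ler_wpM2r ?subr_ge0 ?(ltW x1)//.
  by apply: drift_deriv_noninc => //; exact: ltW.
by rewrite ler_wpM2l// gerBl.
Qed.

(** Being monotone, b' has a right limit at a equal to its supremum on
    ]a, +oo[. This treats a > 0 and a = 0 at once, an infinite limit at 0
    included. *)
Lemma right_limit_derivative_ub (R : realType) (b : R -> R)
    (bH : concave_drift b) (a c : R) : 0 <= a -> a < c ->
  ((derive1 b c)%:E <= right_limit_derivative b a)%E.
Proof.
move=> a0 ac.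
have b'noninc : {in `]a, +oo[ &, nonincreasing_fun (EFin \o derive1 b)}.
  move=> x y; rewrite !in_itv/= !andbT => ax _ xy.
  by rewrite lee_fin; apply: drift_deriv_noninc => //; exact: le_lt_trans ax.
have /cvg_lim := @nonincreasing_at_right_cvge R (EFin \o derive1 b) a +oo%O isT b'noninc.
rewrite /right_limit_derivative /= => -> //.
apply: ereal_sup_ubound; exists c => //=; by rewrite in_itv/= ac.
Qed.

Lemma right_limit_derivativeE (R : realType) (b : R -> R)
    (bH : concave_drift b) (a : R) : 0 < a ->
  right_limit_derivative b a = (derive1 b a)%:E.
Proof.
move=> a0; apply: cvg_lim => //; apply: cvg_EFin; first exact: nearW.
exact/cvg_at_right_filter/(drift_deriv_cont bH a0).
Qed.

Lemma right_limit_derivative_ge0 (R : realType) (b : R -> R)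
    (bH : concave_drift b) (a : R) : 0 <= a ->
  (0 <= right_limit_derivative b a)%E.
Proof.
move=> a0; apply: le_trans (right_limit_derivative_ub bH (c := a + 1) a0 _).
  by rewrite lee_fin drift_deriv_ge0// ltr_wpDl.
by rewrite ltrDl.
Qed.

(** The estimate behind uniqueness: a lower bound a on both arguments (the noise,
    in the application) controls the Lipschitz constant. For a = 0 the
    right-hand side may be +oo, or +oo * 0 = 0 when x = y, and the inequality
    still holds. *)
Lemma drift_lipschitz (R : realType) (b : R -> R) (bH : concave_drift b)
    (a x y : R) : 0 <= a -> a <= x -> a <= y ->
  (`|b x - b y|%:E <= right_limit_derivative b a * `|x - y|%:E)%E.
Proof.
move=> a0; wlog xy : x y / x <= y.
  move=> H ax ay; have [xy|/ltW yx] := leP x y; first exact: H.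
  by rewrite distrC (distrC x); exact: H.
move=> ax ay; rewrite (distrC (b x)) (distrC x).
rewrite ger0_norm ?subr_ge0; last by apply: drift_mono => //; exact: le_trans ax.
rewrite ger0_norm ?subr_ge0//.
move: xy; rewrite le_eqVlt => /predU1P[->|xy]; first by rewrite !subrr mule0.
have [c /andP[xc _] ->] := drift_MVT bH (le_trans a0 ax) xy.
rewrite EFinM; apply: lee_wpmul2r; first by rewrite lee_fin subr_ge0 ltW.
by apply: right_limit_derivative_ub => //; exact: le_lt_trans xc.
Qed.

Lemma measurable_right_limit_derivative (R : realType) (b : R -> R)
    (bH : concave_drift b) :
  measurable_fun [set: R] (fun z : R => right_limit_derivative b `|z|).
Proof.
have mb' : measurable_fun (`]0, +oo[ : set R) (derive1 b).
  apply: open_continuous_measurable_fun; first exact: interval_open.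
  move=> x; rewrite inE/= in_itv/= andbT; exact: drift_deriv_cont.
have -> : (fun z => right_limit_derivative b `|z|) = (fun z : R =>
    if z == 0 then right_limit_derivative b 0
    else ((derive1 b \_ (`]0%R, +oo[ : set R)) `|z|)%:E).
  apply/funext => z; case: eqVneq => [->|z0]; first by rewrite normr0.
  rewrite right_limit_derivativeE ?normr_gt0// patchE ifT// inE/= in_itv/=.
  by rewrite normr_gt0 z0.
apply: measurable_fun_ifT => //.
  exact: measurable_fun_eqr.
apply/measurable_EFinP; apply: measurableT_comp => //.
exact/(measurable_restrictT _ _).1.
Qed.

(** * Gronwall's lemma with an integrable kernel *)

(** Absolute continuity of the integral for a kernel with values in the extended
    reals; it reduces to the real-valued case because an integrable function is
    almost everywhere finite. *)
Lemma integral_small_sets (d : measure_display) (X : measurableType d)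
    (R : realType) (mu : {measure set X -> \bar R}) (D : set X)
    (k : X -> \bar R) : measurable D -> mu.-integrable D k ->
  (forall x, D x -> 0 <= k x)%E -> forall e : R, 0 < e ->
  exists2 r : R, 0 < r & forall A : set X, measurable A -> A `<=` D ->
    (mu A < r%:E)%E -> (\int[mu]_(x in A) k x < e%:E)%E.
Proof.
move=> mD ik k0 e e0; pose f : X -> R := fine \o k.
have mk : measurable_fun D k by exact: measurable_int ik.
have kf : ae_eq mu D k (EFin \o f).
  by apply: filterS (integrable_ae mD ik) => x /= kx Dx; rewrite fineK//; exact: kx.
have mf : measurable_fun D (EFin \o f) by exact/measurable_EFinP/measurableT_comp.
have iF : mu.-integrable D (EFin \o f).
  apply: (le_integrable mD mf _ ik) => // x _; rewrite /f /=.
  by case: (k x) => [r| |] //=; rewrite normr0 leey.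
have : mu.-integrable setT (EFin \o (f \_ D)).
  by rewrite -restrict_EFin; exact/(integrable_mkcond _ mD).1.
move=> /integral_normr_continuous /(_ _ e0)[r [r0 rP]]; exists r => // A mA AD Ar.
rewrite (@ge0_ae_eq_integral _ _ _ mu A k (EFin \o f))//; last 5 first.
- exact: measurable_funS mk.
- exact: measurable_funS mf.
- by move=> x /AD /k0.
- by move=> x /AD /k0 /fine_ge0; rewrite lee_fin.
- exact: ae_eq_subset kf.
have := rP _ mA Ar; rewrite -lte_fin; apply: le_lt_trans.
have -> : (\int[mu]_(x in A) (EFin \o f) x)%E = (\int[mu]_(x in A) `|(f \_ D) x|%:E)%E.
  apply: eq_integral => x; rewrite inE => /AD Dx; rewrite patchE mem_set//=.
  by rewrite ger0_norm// fine_ge0// k0.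
rewrite le_eqVlt fineK ?eqxx// ge0_fin_numE ?integral_ge0//.
have := iF => /integrableP[_]; apply: le_lt_trans.
rewrite [leRHS](_ : _ = \int[mu]_(x in D) `|(f \_ D) x|%:E)%E; last first.
  by apply: eq_integral => x xD; rewrite patchE xD.
apply: ge0_subset_integral => //.
apply/measurable_EFinP/measurableT_comp => //.
apply/measurable_restrict => //; rewrite setIid.
exact/measurable_EFinP.
Qed.

(** Cut [0, T] into steps of a length h over which k has integral at most 1/2.
    If u vanishes up to one grid point, then its maximum up to the next one is at
    most half of itself, so u vanishes up to the next one too. *)
Lemma gronwall_zero (R : realType) (T : R) (k : R -> \bar R) (u : R -> R) :
  measurable_fun (`[0, T] : set R) k -> (forall s, 0 <= s <= T -> (0 <= k s)%E) ->
  (\int[@lebesgue_measure R]_(s in `[0%R, T]) k s < +oo)%E ->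
  {within `[0, T], continuous u} -> (forall t, 0 <= t <= T -> 0 <= u t) ->
  (forall t, 0 <= t <= T ->
    ((u t)%:E <= \int[@lebesgue_measure R]_(s in `[0%R, t]) (k s * (u s)%:E))%E) ->
  forall t, 0 <= t <= T -> u t = 0.
Proof.
pose mu := @lebesgue_measure R; move=> mk k0 kfin cu u0 uk.
have k0D (s : R) : `[0, T]%classic s -> (0 <= k s)%E.
  by rewrite /= in_itv/=; exact: k0.
have mD : measurable (`[0, T] : set R) by exact: measurable_itv.
have ik : mu.-integrable `[0, T] k.
  apply/integrableP; split => //; apply: le_lt_trans kfin.
  by rewrite le_eqVlt; apply/orP; left; apply/eqP/eq_integral => s;
    rewrite inE => /k0D/gee0_abs.
have half0 : (0 : R) < 2^-1 by rewrite invr_gt0.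
have [r r0 rP] := @integral_small_sets _ (measurableTypeR R) _ mu _ _ mD ik k0D _ half0.
pose h := r / 2; have h0 : 0 < h by rewrite divr_gt0.
have hr : h < r by rewrite /h ltr_pdivrMr// mulr_natr mulr2n ltrDl.
suff H n t : 0 <= t <= T -> t <= n%:R * h -> u t = 0.
  move=> t tT; apply: (H (Num.truncn (t / h)).+1) => //.
  by rewrite -ler_pdivrMr// ltW// truncnS_gt.
elim: n t => [|n IH] t /andP[t0 tT].
  rewrite mul0r => t_le0; have -> : t = 0 by apply/eqP; rewrite eq_le t_le0.
  apply/eqP; rewrite eq_le u0 ?lexx ?(le_trans t0)// andbT -lee_fin.
  apply: le_trans (uk 0 _) _; first by rewrite lexx (le_trans t0).
  by rewrite set_itv1 integral_set1.
move=> tn; have ct : {within `[0, t], continuous u}.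
  apply: continuous_subspaceW cu => s /=; rewrite !in_itv/= => /andP[-> st] /=.
  exact: le_trans tT.
have [m] := EVT_max t0 ct; rewrite in_itv/= => /andP[m0 mt] umax.
have ut0 : 0 <= u t by rewrite u0 ?t0.
suff um0 : u m = 0.
  by apply/eqP; rewrite eq_le ut0 andbT -um0 umax// in_itv/= t0 lexx.
have mT : 0 <= m <= T by rewrite m0 (le_trans mt).
have [mn|nm] := leP m (n%:R * h); first exact: IH.
pose A := `]n%:R * h, m]%classic : set (measurableTypeR R).
have nh0 : 0 <= n%:R * h by rewrite mulr_ge0// ltW.
have mA : measurable A by exact: measurable_itv.
have AD : A `<=` `[0, T].
  move=> s; rewrite /A /= !in_itv/= => /andP[/ltW ns sm].
  by rewrite (le_trans nh0 ns) (le_trans sm)//; case/andP: mT.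
have Amu : (mu A < r%:E)%E.
  rewrite /mu /A lebesgue_measure_itv/= lte_fin nm -EFinB lte_fin.
  rewrite (le_lt_trans _ hr)// lerBlDl (le_trans mt)// (le_trans tn)//.
  by rewrite -natr1 mulrDl mul1r.
have Ak := rP A mA AD Amu.
have um_ge0 : 0 <= u m by exact: u0.
have Dm : (`[0, m] : set R) `<=` `[0, T].
  move=> s /=; rewrite !in_itv/= => /andP[-> sm] /=.
  by rewrite (le_trans sm)//; case/andP: mT.
have mDm : measurable (`[0, m] : set R) by exact: measurable_itv.
have mkA : measurable_fun (`[0, m] : set R) (k \_ A).
  by apply/measurable_restrict => //; apply: measurable_funS mk => // s [/Dm].
have kA0 s : (0 <= (k \_ A) s)%E.
  by rewrite patchE; case: ifPn => //; rewrite inE => /AD /k0D.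
have umE : ((u m)%:E <= (2^-1 * u m)%:E)%E.
  apply: le_trans (uk m mT) _.
  (* on [0, m] the product k u vanishes outside A, and u <= u m inside *)
  apply: (@le_trans _ _ (\int[mu]_(s in `[0%R, m]) ((k \_ A) s * (u m)%:E)))%E.
    apply: ge0_le_integral => //.
    - by move=> s /Dm Ds; rewrite mule_ge0 ?k0D// lee_fin u0//; move: Ds; rewrite /= in_itv.
    - apply: emeasurable_funM; first exact: measurable_funS mk.
      apply/measurable_EFinP; apply: subspace_continuous_measurable_fun => //.
      exact: continuous_subspaceW cu.
    - by apply: emeasurable_funM.
    - move=> s /[dup] Ds; rewrite /= in_itv/= => /andP[s0 sm].
      have sT : 0 <= s <= T by rewrite s0 (le_trans sm)//; case/andP: mT.
      rewrite patchE; case: ifPn => sA.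
        by rewrite lee_wpmul2l ?k0// lee_fin umax// in_itv/= s0 (le_trans sm).
      rewrite mul0e IH ?mule0//; move: sA; rewrite notin_setE /A /= in_itv/= => /negP.
      by rewrite sm andbT -leNgt.
  rewrite ge0_integralZr ?lee_fin// EFinM lee_wpmul2r ?lee_fin//.
  rewrite -integral_mkcondr (_ : _ `&` _ = A); first exact: ltW.
  apply/seteqP; split => [s []//|s sA]; split => //.
  by move: sA; rewrite /A /= !in_itv/= => /andP[/ltW ns ->]; rewrite (le_trans nh0).
apply/eqP; rewrite eq_le um_ge0 andbT; move: umE; rewrite lee_fin; lra.
Qed.

(** * Almost sure finiteness of the kernel *)

Lemma floor_grid_cvg (R : realType) (s : R) :
  (Num.floor (s * n.+1%:R))%:~R / n.+1%:R @[n --> \oo] --> s.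
Proof.
apply/cvgrPdist_le => e e0; near=> n.
rewrite ger0_norm; last by rewrite subr_ge0 ler_pdivrMr// floor_le.
apply: (@le_trans _ _ n.+1%:R^-1); last first.
  near: n; have := @cvg_harmonic R => /cvgrPdist_le /(_ _ e0).
  by apply: filterS => m; rewrite sub0r normrN ger0_norm ?invr_ge0.
have n0 : 0 < n.+1%:R :> R by [].
by rewrite -(ler_pM2r n0) mulrBl divfK// mulVf// lerBlDl ltW// -intrD1 floorD1_gt.
Unshelve. all: by end_near. Qed.

(** Freezing the second argument on the grid of mesh 1 / (n + 1) gives functions
    whose preimages are countable unions of measurable rectangles, and they
    converge pointwise to V. *)
Lemma measurable_caratheodory (d : measure_display) (Omega : measurableType d)
    (R : realType) (V : Omega -> R -> R) :
  (forall s, measurable_fun [set: Omega] (V ^~ s)) ->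
  (forall w, continuous (V w)) ->
  measurable_fun [set: Omega * measurableTypeR R] (fun p => V p.1 p.2).
Proof.
move=> mV cV.
pose V_ n (p : Omega * measurableTypeR R) :=
  V p.1 ((Num.floor (p.2 * n.+1%:R))%:~R / n.+1%:R).
apply: (@measurable_fun_cvg _ _ _ _ V_) => [n|p _]; last first.
  exact: (cvg_comp _ _ (@floor_grid_cvg R p.2) (cV p.1 p.2)).
have n0 : 0 < n.+1%:R :> R by [].
move=> _ B mB; rewrite setTI.
rewrite (_ : _ @^-1` _ = \bigcup_(z : int)
    ((fun w => V w (z%:~R / n.+1%:R)) @^-1` B `*`
     [set` `[z%:~R / n.+1%:R, (z + 1)%:~R / n.+1%:R[])); last first.
  apply/seteqP; split => [[w s] /= Bws|[w s] [z _] [/= Bw]].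
    exists (Num.floor (s * n.+1%:R)) => //; split => //=.
    by rewrite in_itv/= ler_pdivrMr// ltr_pdivlMr// floor_le floorD1_gt.
  rewrite in_itv/= ler_pdivrMr// ltr_pdivlMr// -floor_eq => /eqP zE.
  by rewrite /V_ /= zE.
apply: countable_bigcupT_measurable; first exact: countableP.
move=> z; apply: measurableX; last exact: measurable_itv.
by rewrite -[X in measurable X]setTI; exact: mV.
Qed.

(** The integral of a non-negative function f is the supremum of the integrals
    of the simple functions below f, whether or not f is measurable. Setting g to
    0 on the exceptional set gives a measurable function below f, so its integral
    is also finite. *)
Lemma ae_fin_num_lower_integral (d : measure_display) (X : measurableType d)
    (R : realType) (mu : {measure set X -> \bar R}) (f g : X -> \bar R) :
  (forall x, 0 <= f x)%E -> (forall x, 0 <= g x)%E ->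
  measurable_fun setT g -> {ae mu, forall x, f x = g x} ->
  (\int[mu]_x f x < +oo)%E -> {ae mu, forall x, (f x < +oo)%E}.
Proof.
move=> f0 g0 mg [N [mN N0 fgN]] foo.
pose h := g \_ (~` N).
have h0 x : (0 <= h x)%E by exact: erestrict_ge0.
have mh : measurable_fun setT h.
  by apply/(measurable_restrictT _ _).1; [exact: measurableC|exact: measurable_funTS].
have hE x : ~ N x -> h x = f x.
  move=> Nx; rewrite /h patchE mem_set//; apply/esym.
  by apply: contrapT => fg; apply: Nx; exact: fgN.
have hf x : (h x <= f x)%E.
  have [Nx|/hE->//] := pselect (N x).
  by rewrite /h patchE memNset// => /(_ Nx).
have ih : mu.-integrable setT h.
  apply/integrableP; split => //.
  under eq_integral do rewrite gee0_abs//.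
  apply: le_lt_trans foo; rewrite !ge0_integralTE//; apply: le_ereal_sup.
  by move=> _ [k kh <-]; exists k => //= x; exact: le_trans (hf x).
apply: filterS2 (integrable_ae measurableT ih)
  (_ : {ae mu, forall x, f x = h x}) => [x /(_ I) hfin fh|].
  by rewrite fh ltey_eq hfin.
by exists N; split => // x /= fh; apply: contrapT => /hE /esym.
Qed.

(** The metric projection onto [0, T]: composing with it extends a path that is
    continuous on [0, T] to one that is continuous on the whole line. *)
Definition clamp (R : realType) (T s : R) : R := Num.max 0 (Num.min s T).

Lemma clamp_itv (R : realType) (T s : R) : 0 <= T -> 0 <= clamp T s <= T.
Proof. by move=> T0; rewrite /clamp le_max lexx/= ge_max T0 ge_min lexx orbT. Qed.

Lemma clamp_id (R : realType) (T s : R) : 0 <= s <= T -> clamp T s = s.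
Proof. by move=> /andP[s0 sT]; rewrite /clamp min_l// max_r. Qed.

Lemma continuous_clamp (R : realType) (T : R) : continuous (clamp T).
Proof.
move=> s; have ct (c : R) : {for s, continuous (cst c : R -> R^o)} by exact: cvg_cst.
have ci : {for s, continuous (idfun : R -> R^o)} by exact: cvg_id.
exact: (continuous_max (ct 0) (continuous_min ci (ct T))).
Qed.

Lemma continuous_comp_within (X Y Z : topologicalType) (A : set Y)
    (r : X -> Y) (f : Y -> Z) : continuous r -> (forall x, A (r x)) ->
  {within A, continuous f} -> continuous (f \o r).
Proof.
move=> cr rA /subspace_continuousP cf x U /(cf _ (rA x)).
rewrite /= /within /= => fU; change (nbhs x (fun z => U (f (r z)))).
have := cr x _ fU; rewrite nbhs_simpl /=.
by apply: filterS => z /=; apply; exact: rA.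
Qed.

(** Stated for an arbitrary non-negative measurable g: a finite expected time
    integral along W is finite along almost every path. *)
Lemma ae_path_regularity (R : realType) (d : measure_display)
    (Omega : measurableType d) (P : probability Omega R) (T : R)
    (W : R -> Omega -> R) (g : R -> \bar R) : 0 <= T ->
  (forall t, 0 <= t <= T -> measurable_fun [set: Omega] (W t)) ->
  {ae P, forall w, {within `[0, T], continuous (fun t => W t w)}} ->
  measurable_fun [set: R] g -> (forall z, 0 <= g z)%E ->
  (\int[P]_w \int[@lebesgue_measure R]_(s in `[0%R, T]) g (W s w) < +oo)%E ->
  {ae P, forall w, {within `[0, T], continuous (fun t => W t w)} /\
    (\int[@lebesgue_measure R]_(s in `[0%R, T]) g (W s w) < +oo)%E}.
Proof.
move=> T0 mW cW mg g0 goo.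
have [N [mN N0 cWN]] := cW.
apply: filterS2 cW (_ : {ae P, forall w,
   (\int[@lebesgue_measure R]_(s in `[0%R, T]) g (W s w) < +oo)%E}) => //.
(* V is W with the exceptional paths replaced by 0, frozen outside [0, T]. *)
pose V w s := if w \in N then 0 else W (clamp T s) w.
have cV w : continuous (V w).
  rewrite /V; case: (boolP (w \in N)) => wN; first by move=> s; exact: cvg_cst.
  apply: (@continuous_comp_within _ _ _ `[0, T]%classic (clamp T) (fun t => W t w)).
  - exact: continuous_clamp.
  - by move=> s; rewrite /= in_itv/= clamp_itv.
  - by apply: contrapT => cw; move/negP: wN; apply; rewrite inE; exact: cWN.
have mV s : measurable_fun [set: Omega] (V ^~ s).
  apply: measurable_fun_ifT => //; last by apply: mW; exact: clamp_itv.
  by apply: (measurable_fun_bool true); rewrite setTI preimage_mem_true.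
pose D := `[0, T]%classic : set (measurableTypeR R).
have mD : measurable D by exact: measurable_itv.
have mgV : measurable_fun setT (fun p : Omega * measurableTypeR R =>
    if p.2 \in D then g (V p.1 p.2) else 0%E).
  apply: measurable_fun_ifT => //.
    apply: (measurableT_comp (f := fun s => s \in D)) => //.
    by apply: (measurable_fun_bool true); rewrite setTI preimage_mem_true.
  exact: measurableT_comp mg (measurable_caratheodory mV cV).
have := measurable_fun_fubini_tonelli_F (m2 := @lebesgue_measure R) _ mgV.
rewrite /fubini_F/= => /(_ _)/= mF.
apply: (ae_fin_num_lower_integral _ _ (mF _) _ goo).
- by move=> w; apply: integral_ge0.
- by move=> w; apply: integral_ge0 => s _; case: ifPn.
- by move=> p; case: ifPn.
exists N; split => // w /= Hw; apply: contrapT => wN; apply: Hw.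
rewrite [LHS]integral_mkcond; apply: eq_integral => s _.
rewrite patchE; case: ifPn => // sT; rewrite /V memNset//.
by rewrite clamp_id//; move: sT; rewrite inE/= in_itv.
Qed.

(** * Existence by monotone Picard iteration *)

Lemma continuous_affine_expR (R : realType) (A L M : R) :
  continuous (fun s => A + L * (M * expR (L * s))).
Proof.
move=> s; apply: cvgD; first exact: cvg_cst.
apply: cvgM; first exact: cvg_cst.
apply: cvgM; first exact: cvg_cst.
apply: (cvg_comp (fun z => L * z) expR); last exact: continuous_expR.
by apply: cvgM; [exact: cvg_cst|exact: cvg_id].
Qed.

(** The envelope M * expR (L * t) used below is a supersolution of the integral
    equation with drift A + L x; this is the integral that shows it. *)
Lemma Rintegral_affine_expR (R : realType) (A L M t : R) : 0 <= t ->
  \int[@lebesgue_measure R]_(s in `[0, t]) (A + L * (M * expR (L * s))) =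
  A * t + M * expR (L * t) - M.
Proof.
rewrite le_eqVlt => /predU1P[<-|t0].
  by rewrite set_itv1 Rintegral_set1 !mulr0 expR0 mulr1 add0r subrr.
pose F s : R := A * s + M * expR (L * s).
pose f s : R := A + L * (M * expR (L * s)).
have dL (s : R) : is_derive s (1 : R) (fun z : R => L * z) L.
  by apply: (is_derive_eq (is_deriveZ L (is_derive_id s 1))); rewrite /GRing.scale/= mulr1.
have dE (s : R) : is_derive s (1 : R) (fun z : R => expR (L * z)) (expR (L * s) * L).
  exact: (is_derive1_comp (is_derive_expR (L * s)) (dL s)).
have dF (s : R) : is_derive s (1 : R) F (f s).
  have dA : is_derive s (1 : R) (fun z : R => A * z) A.
    by apply: (is_derive_eq (is_deriveZ A (is_derive_id s 1))); rewrite /GRing.scale/= mulr1.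
  apply: (is_derive_eq (is_deriveD dA (is_deriveZ M (dE s)))).
  by rewrite /f /GRing.scale/=; ring.
have cF : continuous F.
  by move=> s; apply/differentiable_continuous/derivable1_diffP; case: (dF s).
rewrite /Rintegral (@continuous_FTC2 _ f F) //.
- by rewrite /F !mulr0 expR0 mulr1 add0r.
- exact/continuous_subspaceT/continuous_affine_expR.
- split; first by move=> s _; case: (dF s).
  + exact/cvg_at_right_filter/cF.
  + exact/cvg_at_left_filter/cF.
- by move=> s _; rewrite derive1E; case: (dF s).
Qed.

(** The iterates started at phi increase because beta is monotone and
    non-negative. They stay below M * expR (L * t), where M is the maximum of
    phi plus A * T, because beta is bounded by A + L x. Dominated convergence
    passes to the limit under the integral. *)
Lemma picard_existence (R : realType) (T A L : R) (beta phi : R -> R) :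
  let mu := @lebesgue_measure R in
  0 <= T -> 0 <= A -> 0 <= L -> continuous beta ->
  {homo beta : x y / x <= y} -> (forall x, 0 <= beta x) ->
  (forall x, 0 <= x -> beta x <= A + L * x) ->
  {within `[0, T], continuous phi} -> (forall t, 0 <= t <= T -> 0 <= phi t) ->
  exists x : R -> R,
    [/\ {within `[0, T], continuous x},
        mu.-integrable `[0, T] (fun s => (beta (x s))%:E),
        forall t, 0 <= t <= T -> 0 <= x t &
        forall t, 0 <= t <= T ->
          x t = \int[mu]_(s in `[0, t]) beta (x s) + phi t].
Proof.
move=> mu T0 A0 L0 cbeta beta_homo beta0 betaAL cphi phi0.
have subT t : t <= T -> (`[0, t]%classic : set R) `<=` `[0, T].
  by move=> tT s /=; rewrite !in_itv/= => /andP[-> st]; exact: le_trans tT.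
have cint x : {within `[0, T], continuous x} ->
    mu.-integrable `[0, T] (EFin \o (beta \o x)).
  move=> cx; apply: continuous_compact_integrable; first exact: segment_compact.
  by apply: within_continuous_comp => // s _; exact: cbeta.
have cint_t x t : t <= T -> {within `[0, T], continuous x} ->
    mu.-integrable `[0, t] (EFin \o (beta \o x)).
  move=> tT cx; apply: integrableS (cint _ cx) => //; exact: subT.
pose Phi (x : R -> R) t := \int[mu]_(s in `[0, t]) (beta \o x) s + phi t.
have cPhi x : mu.-integrable `[0, T] (EFin \o (beta \o x)) ->
    {within `[0, T], continuous (Phi x)}.
  move=> ix.
  exact: (within_continuousD (parameterized_integral_continuous T0 ix) cphi).
pose X n := iter n Phi phi.
have cX n : {within `[0, T], continuous (X n)}.
  by elim: n => // n IH; apply/cPhi/cint.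
have X_ge0 n t : 0 <= t <= T -> 0 <= X n t.
  case: n => [|n] tT; first exact: phi0.
  by apply: addr_ge0; [apply: Rintegral_ge0 => s _; exact: beta0|exact: phi0].
have [K Kphi] : exists K : R, forall t, 0 <= t <= T -> phi t <= K.
  have [c _ cmax] := EVT_max T0 cphi; exists (phi c) => t tT.
  by apply: cmax; rewrite in_itv.
pose M := K + A * T.
have X_le n t : 0 <= t <= T -> X n t <= M * expR (L * t).
  elim: n t => [|n IH] t /andP[t0 tT].
    have M0 : 0 <= M.
      by rewrite addr_ge0 ?mulr_ge0// (le_trans (phi0 0 _) (Kphi 0 _))// lexx.
    rewrite (le_trans (Kphi t _)) ?t0// (@le_trans _ _ M)//.
      by rewrite lerDl mulr_ge0.
    by rewrite ler_peMr// -expR0 ler_expR mulr_ge0.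
  apply: (@le_trans _ _ (A * t + M * expR (L * t) - M + K)).
    rewrite /= lerD ?Kphi ?t0// -Rintegral_affine_expR//.
    apply: le_Rintegral => //; first exact: cint_t.
      apply: continuous_compact_integrable; first exact: segment_compact.
      exact/continuous_subspaceT/continuous_affine_expR.
    move=> s /subT => /(_ tT); rewrite /= in_itv/= => sT.
    apply: le_trans (betaAL _ (X_ge0 n s sT)) _.
    by rewrite lerD2l ler_wpM2l// IH.
  have : A * t <= A * T by rewrite ler_wpM2l.
  by rewrite /M; lra.
have X_ndecr n t : 0 <= t <= T -> X n t <= X n.+1 t.
  elim: n t => [|n IH] t /andP[t0 tT]; first by rewrite lerDr Rintegral_ge0// => s _; exact: beta0.
  change (Phi (X n) t <= Phi (X n.+1) t); rewrite lerD2r.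
  apply: le_Rintegral => //; [exact: (cint_t (X n))|exact: (cint_t (X n.+1))|].
  move=> s /subT => /(_ tT); rewrite /= in_itv/= => sT.
  exact/beta_homo/IH.
pose B := M * expR (L * T).
have X_leB n t : 0 <= t <= T -> X n t <= B.
  move=> /[dup] tT0 /andP[t0 tT]; apply: le_trans (X_le n t tT0) _.
  rewrite ler_wpM2l ?ler_expR ?ler_wpM2l//.
  by rewrite addr_ge0 ?mulr_ge0// (le_trans (phi0 0 _) (Kphi 0 _))// lexx.
pose x t := limn (X ^~ t).
have Xx t : 0 <= t <= T -> X n t @[n --> \oo] --> x t.
  move=> tT; apply: nondecreasing_is_cvgn.
    by apply/nondecreasing_seqP => n; exact: X_ndecr.
  by exists B => _ [n _ <-]; exact: X_leB.
have x_ge0 t : 0 <= t <= T -> 0 <= x t.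
  move=> tT; apply: limr_ge; first by apply: cvgP; exact: Xx.
  by apply: nearW => n; exact: X_ge0.
have mX n : measurable_fun (`[0, T]%classic : set (measurableTypeR R)) (X n).
  by apply: subspace_continuous_measurable_fun; [exact: measurable_itv|exact: cX].
have mx : measurable_fun (`[0, T]%classic : set (measurableTypeR R)) x.
  apply: (measurable_fun_cvg mX) => s; rewrite /= in_itv; exact: Xx.
have mbeta : measurable_fun [set: R] beta by exact: continuous_measurable_fun.
have DC t : 0 <= t <= T -> mu.-integrable `[0, t] (fun s => (beta (x s))%:E) /\
   \int[mu]_(s in `[0, t]) (beta \o X n) s @[n --> \oo] -->
     \int[mu]_(s in `[0, t]) beta (x s).
  move=> /andP[t0 tT].
  have [||||||ix _ cx] := @dominated_convergence _ (measurableTypeR R) R mu `[0, t]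
     _ (fun n s => (beta (X n s))%:E) (fun s => (beta (x s))%:E) (cst (beta B)%:E).
  - exact: measurable_itv.
  - move=> n; apply/measurable_EFinP; apply: measurableT_comp => //.
    by apply: measurable_funS (mX n) => //; exact: subT.
  - apply/measurable_EFinP; apply: measurableT_comp => //.
    by apply: measurable_funS mx => //; exact: subT.
  - apply: aeW => s /subT => /(_ tT); rewrite /= in_itv/= => sT.
    apply: cvg_EFin; first exact: nearW.
    exact: (cvg_comp _ _ (Xx s sT) (cbeta (x s))).
  - apply/integrableP; split; first exact: measurable_cst.
    rewrite integral_cst//= lebesgue_measure_itv/=.
    by case: ifP => _; rewrite -?EFinD -?EFinM ?mule0 ltry.
  - apply: aeW => s n /subT => /(_ tT); rewrite /= in_itv/= => sT.
    by rewrite lee_fin ger0_norm// beta_homo// X_leB.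
  split=> //; apply: fine_cvg; rewrite fineK//.
  exact: integrable_fin_num ix.
have xE t : 0 <= t <= T -> x t = Phi x t.
  move=> tT; have [_ ct] := DC t tT.
  have c1 : X n.+1 t @[n --> \oo] --> x t by rewrite (cvg_shiftS (X ^~ t)); exact: Xx.
  apply: (cvg_unique _ c1) => //; apply: cvgD; [exact: ct|exact: cvg_cst].
have ix : mu.-integrable `[0, T] (fun s => (beta (x s))%:E).
  by apply: (DC T _).1; rewrite T0 lexx.
exists x; split => //.
apply: subspace_eq_continuous (cPhi x ix) => t; rewrite inE/= in_itv/= => tT.
exact/esym/xE.
Qed.

(** * Path-by-path solutions *)

Lemma nonneg_solution_ge (R : realType) (T : R) (b om x : R -> R)
    (bH : concave_drift b) : path_solution T b om x -> nonneg_path T x ->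
  forall t, 0 <= t <= T -> `|om t| <= x t.
Proof.
move=> [_ _ xE] x0 t tT; rewrite xE// lerDr Rintegral_ge0// => s.
rewrite /= in_itv/= => /andP[s0 st]; apply: (drift_ge0 bH); apply: x0.
by rewrite s0 (le_trans st)//; case/andP: tT.
Qed.

(** Both solutions stay above the noise, so drift_lipschitz applies with the
    lower bound |om s| and the difference satisfies Gronwall's inequality. *)
Lemma nonneg_solutions_agree (R : realType) (T : R) (b om x y : R -> R)
    (bH : concave_drift b) : {within `[0, T], continuous om} ->
  (\int[@lebesgue_measure R]_(s in `[0%R, T])
     right_limit_derivative b `|om s|%R < +oo)%E ->
  path_solution T b om x -> nonneg_path T x ->
  path_solution T b om y -> nonneg_path T y -> agree_on_horizon T x y.
Proof.
pose mu := @lebesgue_measure R.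
move=> com kfin solx x0 soly y0 t tT; apply/eqP; rewrite -subr_eq0 -normr_eq0.
have x_ge := nonneg_solution_ge bH solx x0.
have y_ge := nonneg_solution_ge bH soly y0.
have [cx ix xE] := solx; have [cy iy yE] := soly.
have mk : measurable_fun (`[0, T]%classic : set (measurableTypeR R))
    (fun s => right_limit_derivative b `|om s|).
  apply: measurableT_comp (measurable_right_limit_derivative bH) _.
  by apply: subspace_continuous_measurable_fun => //; exact: measurable_itv.
have cxy : {within `[0, T], continuous (fun s => x s - y s)}.
  by move=> s; apply: continuousB; [exact: cx|exact: cy].
have cu : {within `[0, T], continuous (fun s => `|x s - y s|)}.
  by apply: within_continuous_comp cxy => s _; exact: norm_continuous.
apply/eqP; apply: (gronwall_zero mk _ kfin cu _ _ tT) => //.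
  by move=> s _; exact: right_limit_derivative_ge0.
move=> {tT}t /andP[t0 tT].
have subT : (`[0, t]%classic : set R) `<=` `[0, T].
  by move=> s /=; rewrite !in_itv/= => /andP[-> st]; exact: le_trans tT.
have mDt : measurable (`[0, t]%classic : set (measurableTypeR R)).
  exact: measurable_itv.
have ixt : mu.-integrable `[0, t] (EFin \o (b \o x)) by exact: integrableS ix.
have iyt : mu.-integrable `[0, t] (EFin \o (b \o y)) by exact: integrableS iy.
have ib : mu.-integrable `[0, t] (EFin \o (fun s => b (x s) - b (y s))).
  exact: (integrableB mDt ixt iyt).
have ibn : mu.-integrable `[0, t] (EFin \o (fun s => `|b (x s) - b (y s)|)).
  exact: (integrable_norm ib).
have -> : x t - y t = \int[mu]_(s in `[0, t]) (b (x s) - b (y s)).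
  by rewrite xE ?t0// yE ?t0// RintegralB//; ring.
apply: (@le_trans _ _ (\int[mu]_(s in `[0, t]) `|b (x s) - b (y s)|)%:E).
  by rewrite lee_fin; exact: le_normr_Rintegral.
rewrite /Rintegral fineK; last exact: integrable_fin_num ibn.
apply: ge0_le_integral => //.
- exact: measurable_int ibn.
- apply: emeasurable_funM; first exact: measurable_funS mk.
  apply/measurable_EFinP.
  apply: subspace_continuous_measurable_fun => //.
  exact: continuous_subspaceW cu.
- move=> s /subT; rewrite /= in_itv/= => sT.
  by apply: drift_lipschitz => //; [exact: x_ge|exact: y_ge].
Qed.

(** Let tau be the first time at which y <= - eps. Before tau the drift along y is
    non-negative, hence y tau >= |om tau| >= 0, a contradiction. So the drift is
    non-negative along all of y, which therefore stays above |om|. *)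
Lemma solution_nonneg (R : realType) (T eps : R) (b om y : R -> R)
    (bH : concave_drift b) : 0 < eps ->
  (forall x, - eps < x < 0 -> 0 <= b x) ->
  path_solution T b om y -> nonneg_path T y.
Proof.
move=> eps0 b_eps [cy iy yE].
have b_ge0 z : - eps < z -> 0 <= b z.
  move=> ez; have [z0|z0] := ltP z 0; last exact: drift_ge0.
  by apply: b_eps; rewrite ez.
have subT t : t <= T -> (`[0, t]%classic : set R) `<=` `[0, T].
  by move=> tT s /=; rewrite !in_itv/= => /andP[-> st]; exact: le_trans tT.
have y_eps t : 0 <= t <= T -> - eps < y t.
  move=> tT; rewrite ltNge; apply/negP => yt.
  have T0 : 0 <= T by case/andP: tT => t0; exact: le_trans.
  pose S := `[0, T]%classic `&` (y \o clamp T) @^-1` [set z | z <= - eps].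
  have cS : compact S.
    apply: (subclosed_compact _ (@segment_compact R 0 T)); last by move=> s [].
    apply: closedI; first exact: interval_closed.
    apply: closed_comp; last exact: closed_le.
    move=> s _; apply: (@continuous_comp_within _ _ _ `[0, T]%classic) => //.
      exact: continuous_clamp.
    by move=> z; rewrite /= in_itv/= clamp_itv.
  have S0 : S !=set0 by exists t; split; rewrite /= ?in_itv// clamp_id.
  have [tau] := @compact_EVT_min _ _ id S S0 cS (continuous_subspaceT (fun _ => cvg_id)).
  rewrite inE => -[]; rewrite /= in_itv/= => /[dup] tauT /andP[tau0 tau_le].
  rewrite clamp_id// => ytau taumin.
  have : 0 <= y tau.
    (* the sign of b (y tau) is unknown, so the end point is removed *)
    rewrite yE// addr_ge0// -Rintegral_itv_bndo_bndc; last first.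
      apply: integrableS iy => // s; rewrite /= !in_itv/= => /andP[-> /ltW st].
      exact: le_trans tau_le.
    apply: Rintegral_ge0 => s; rewrite /= in_itv/= => /andP[s0 stau].
    apply: b_ge0; rewrite ltNge; apply/negP => ys.
    have sT : 0 <= s <= T by rewrite s0 (le_trans (ltW stau)).
    have := taumin s; rewrite inE /= leNgt stau => H; suff : false by [].
    by apply: H; split; rewrite /= ?in_itv//= clamp_id.
  by rewrite leNgt (le_lt_trans ytau)// oppr_lt0.
move=> t /[dup] tT /andP[t0 t_le]; rewrite yE// addr_ge0// Rintegral_ge0// => s /subT.
by rewrite /= in_itv/= => /(_ t_le) sT; exact/b_ge0/y_eps.
Qed.

Lemma nonneg_solution_exists (R : realType) (T : R) (b om : R -> R)
    (bH : concave_drift b) : 0 <= T -> {within `[0, T], continuous om} ->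
  exists x : R -> R, path_solution T b om x /\ nonneg_path T x.
Proof.
(* beta extends b from the non-negative half-line, keeping it continuous and
   monotone on all of R. *)
move=> T0 com; pose beta := b \o Num.max (0 : R).
have max0 (z : R) : 0 <= Num.max 0 z by rewrite le_max lexx.
have betaE z : 0 <= z -> beta z = b z by move=> z0; rewrite /beta /= max_r.
have cbeta : continuous beta.
  apply: (continuous_comp_within _ _ (drift_cont bH)).
    move=> s; have c0 : {for s, continuous (cst 0 : R -> R^o)} by exact: cvg_cst.
    have ci : {for s, continuous (idfun : R -> R^o)} by exact: cvg_id.
    exact: (continuous_max c0 ci).
  by move=> z; rewrite /= in_itv/= andbT.
have cphi : {within `[0, T], continuous (fun t => `|om t|)}.
  by apply: within_continuous_comp com => s _; exact: norm_continuous.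
have [|z|z z0|t _|x [cx ix x0 xE]] := picard_existence T0
    (drift_ge0 bH ler01) (drift_deriv_ge0 bH ltr01) cbeta _ _ _ cphi.
- move=> z w zw; apply: (drift_mono bH) => //.
  by rewrite ge_max max0 /= le_max zw orbT.
- exact: (drift_ge0 bH).
- by rewrite betaE//; exact: drift_affine_bound.
- exact: normr_ge0.
exists x; split => //; split => //.
  apply: eq_integrable ix => // s; rewrite inE/= in_itv/= => sT.
  by rewrite betaE// x0.
move=> t /[dup] tT /andP[t0 tT']; rewrite xE//; congr (_ + _).
apply: eq_Rintegral => s; rewrite inE/= in_itv/= => /andP[s0 st].
by rewrite betaE// x0// s0 (le_trans st).
Qed.

Theorem proposition2p9 (R : realType) (d : measure_display)
    (Omega : measurableType d) (P : probability Omega R) (T : R) (T_gt0 : 0 < T)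
    (W : R -> Omega -> R) (W_bm : brownian_motion P T W)
    (b : R -> R) (b_meas : measurable_fun [set: R] b)
    (H1 : b 0 = 0)
    (H2 : forall x y : R, 0 < x -> x <= y -> b x <= b y)
    (H3_cont : {within `[0, +oo[, continuous b})
    (H3_derivable : forall x : R, 0 < x -> derivable b x 1)
    (H3_C1 : forall x : R, 0 < x -> {for x, continuous (derive1 b)})
    (H3_noninc : forall x y : R, 0 < x -> x <= y -> derive1 b y <= derive1 b x)
    (H7 : (\int[P]_w \int[@lebesgue_measure R]_(s in `[0%R, T])
             right_limit_derivative b `|W s w|%R < +oo)%E) :
  {ae P, forall w, forall x y : R -> R,
     path_solution T b (fun t => W t w) x -> nonneg_path T x ->
     path_solution T b (fun t => W t w) y -> nonneg_path T y ->
     agree_on_horizon T x y} /\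
  (forall eps : R, 0 < eps -> (forall x : R, - eps < x < 0 -> 0 <= b x) ->
     {ae P, forall w, exists x : R -> R,
        [/\ path_solution T b (fun t => W t w) x,
            nonneg_path T x &
            forall y : R -> R, path_solution T b (fun t => W t w) y ->
              agree_on_horizon T y x]}).
Proof.
have bH : concave_drift b by [].
have T0 := ltW T_gt0.
have reg := ae_path_regularity T0 (bm_measurable W_bm) (bm_continuous W_bm)
  (measurable_right_limit_derivative bH)
  (fun z => right_limit_derivative_ge0 bH (normr_ge0 z)) H7.
split=> [|eps eps0 b_eps]; apply: filterS reg => w [cW kfin].
  by move=> x y solx x0 soly y0; exact: nonneg_solutions_agree solx x0 soly y0.
have [x [solx x0]] := nonneg_solution_exists bH T0 cW.
exists x; split => // y soly.
have y0 : nonneg_path T y := solution_nonneg bH eps0 b_eps soly.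
exact: nonneg_solutions_agree soly y0 solx x0.
Qed.
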